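(* Let $k$ be a field, $S=k[x_1,\dots,x_n]$, $B\subset S$ an ideal generated by square-free monomials, and let $$0\to M\xrightarrow{\ \rho\ }\mathbf{Z}^n\xrightarrow{\ \phi\ }\mathbf{D}\to 0$$ be an exact sequence of abelian groups; regard $M$ as a subgroup of $\mathbf{Z}^n$ via $\rho$. Let $i\ge 0$. Then $(p+M)\cap L_I$ is finite for every $I\in\Sigma_i$ and every $p\in\mathbf{Z}^n$ if and only if $H^i_B(S)_\delta$ is a finite dimensional $k$-vector space for every $\delta\in\mathbf{D}$.
   Context: $S$ and $H^i_B(S)$ (local cohomology with supports in $B$) are $\mathbf{Z}^n$-graded with $\deg x_j=e_j$. A $\mathbf{Z}^n$-graded module $N$ is regarded as $\mathbf{D}$-graded by $N_\delta=\bigoplus_{p\in\phi^{-1}(\delta)}N_p$. For $p\in\mathbf{Z}^n$ put $\mathrm{neg}(p)=\{j\mid p_j<0\}$, and for $I\subset\{1,\dots,n\}$ put $L_I=\{p\in\mathbf{Z}^n\mid\mathrm{neg}(p)=I\}$. The vector space $H^i_B(S)_p$ depends, up to isomorphism, only on $\mathrm{neg}(p)$, and $\Sigma_i=\{I\subset\{1,\dots,n\}\mid H^i_B(S)_p\neq 0\text{ for }p\in L_I\}$. *)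

(* Defs.v *)
From HB Require Import structures.
From mathcomp Require Import all_boot all_order all_algebra.
From mathcomp Require Import mpoly.

Set Implicit Arguments.
Unset Strict Implicit.
Unset Printing Implicit Defensive.

Import Order.TTheory GRing.Theory Num.Theory.

Local Open Scope ring_scope.

Notation Zn n := 'rV[int]_n.

Definition neg (n : nat) (p : Zn n) : {set 'I_n} := [set j | p ord0 j < 0].

Definition finite_pred (T : eqType) (P : T -> Prop) : Prop :=
  exists s : seq T, forall x, P x -> x \in s.

(** * Graded modules over [S = k[x_1, ..., x_n]] *)

Definition mdegZ (n : nat) (m : 'X_{1..n}) : Zn n := \row_j (m j)%:Z.

(* [S_p]: it is [k x^p] when [p >= 0], and [0] otherwise. *)
Definition Sdeg (k : fieldType) (n : nat) (p : Zn n) (f : {mpoly k[n]}) : Prop :=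
  forall m, m \in msupp f -> mdegZ m = p.

(* [N q] is the homogeneous component of degree [q]; the last two clauses say
   that the module is the direct sum of its homogeneous components. *)
Record is_grading (k : fieldType) (n : nat) (V : lmodType {mpoly k[n]})
    (N : Zn n -> V -> Prop) : Prop := IsGrading {
  grading_0 : forall q, N q 0;
  grading_B : forall q u v, N q u -> N q v -> N q (u - v);
  grading_Z : forall p q a v, Sdeg p a -> N q v -> N (p + q) (a *: v);
  grading_span : forall v, exists (s : seq (Zn n)) (f : Zn n -> V),
    [/\ uniq s, forall q, N q (f q) & v = \sum_(q <- s) f q];
  grading_indep : forall (s : seq (Zn n)) (f : Zn n -> V),
    uniq s -> (forall q, N q (f q)) -> \sum_(q <- s) f q = 0 ->
    forall q, q \in s -> f q = 0
}.

Record gmod (k : fieldType) (n : nat) := GMod {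
  gm_sort :> lmodType {mpoly k[n]};
  gm_deg : Zn n -> gm_sort -> Prop;
  gm_grading : is_grading gm_deg
}.

Arguments gm_deg {k n} _ _ _.

(* Morphisms of graded modules are the [S]-linear maps of degree [0]. *)
Definition homogeneous (k : fieldType) (n : nat) (A C : gmod k n)
    (f : A -> C) : Prop :=
  forall p v, gm_deg A p v -> gm_deg C p (f v).

Lemma Sdeg_grading (k : fieldType) (n : nat) :
  @is_grading k n {mpoly k[n]}^o (@Sdeg k n).
Proof.
split.
- by move=> q m; rewrite msupp0.
- move=> q u v hu hv m /msuppB_le.
  by rewrite mem_cat => /orP[/hu|/hv].
- move=> p q a v ha hv m /msuppM_le /allpairsP[[m1 m2] /= [h1 h2 ->]].
  rewrite -(ha _ h1) -(hv _ h2); apply/rowP => j.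
  by rewrite !mxE mnmDE PoszD.
- move=> v; exists [seq mdegZ m | m <- msupp v].
  exists (fun q => \sum_(m <- msupp v | mdegZ m == q) v@_m *: 'X_[m]).
  have inj : injective (@mdegZ n).
    move=> m1 m2 /rowP e; apply/mnmP => j.
    by have := e j; rewrite !mxE => -[].
  split.
  + by rewrite map_inj_uniq // msupp_uniq.
  + move=> q m; rewrite mcoeff_msupp => nz.
    apply/eqP; apply: contraNT nz => ne.
    rewrite raddf_sum /= big1_seq // => m' /andP[/eqP e _].
    rewrite mcoeffZ mcoeffX; case: eqP => [e'|]; last by rewrite mulr0.
    by rewrite -e' e eqxx in ne.
  + rewrite big_map [LHS]mpolyE; apply: eq_big_seq => m hm.
    rewrite (eq_bigl (pred1 m)); last by move=> m' /=; rewrite (inj_eq inj).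
    by rewrite -big_filter filter_pred1_uniq ?msupp_uniq // big_seq1.
- move=> s f us hf h0 q hq; apply/mpolyP => m; rewrite mcoeff0.
  have [e|ne] := eqVneq (mdegZ m) q; last first.
    by apply: memN_msupp_eq0; apply: contra ne => /hf /eqP.
  have := congr1 (mcoeff m) h0.
  rewrite raddf_sum /= mcoeff0 (bigD1_seq q) //= big1 ?addr0 // => q' ne'.
  apply: memN_msupp_eq0; apply: contra ne' => /hf <-.
  by rewrite e.
Qed.

(* [S] as a graded module over itself, with [deg x_j = e_j]. *)
Definition Sgmod (k : fieldType) (n : nat) : gmod k n :=
  GMod (Sdeg_grading k n).

(** * Square-free monomial ideals and torsion *)

Definition squarefree (n : nat) (m : 'X_{1..n}) : bool := [forall j, m j <= 1]%N.

Definition generated_by_squarefree_monomials (k : fieldType) (n : nat)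
    (B : {mpoly k[n]} -> Prop) : Prop :=
  exists2 G : seq 'X_{1..n}, all (@squarefree n) G &
    forall f, B f <->
      exists c : 'X_{1..n} -> {mpoly k[n]}, f = \sum_(m <- G) c m * 'X_[m].

Fixpoint ideal_pow (R : comNzRingType) (B : R -> Prop) (l : nat) : R -> Prop :=
  if l is l'.+1 then fun f =>
    exists2 s : seq (R * R),
      forall ab, ab \in s -> B ab.1 /\ ideal_pow B l' ab.2 &
      f = \sum_(ab <- s) ab.1 * ab.2
  else fun _ => True.

(* The functor [Gamma_B]. *)
Definition torsion (R : comNzRingType) (B : R -> Prop) (V : lmodType R)
    (v : V) : Prop :=
  exists l : nat, forall b, ideal_pow B l b -> b *: v = 0.

(** * Local cohomology: the right derived functors of [Gamma_B] *)

Definition graded_injective (k : fieldType) (n : nat) (E : gmod k n) : Prop :=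
  forall (A C : gmod k n) (f : {linear A -> C}) (g : {linear A -> E}),
    homogeneous f -> homogeneous g -> injective f ->
    exists2 h : {linear C -> E}, homogeneous h & forall v, h (f v) = g v.

Record injective_resolution (k : fieldType) (n : nat) (N : gmod k n) :=
  InjectiveResolution {
    ir_obj : nat -> gmod k n;
    ir_d : forall j, {linear ir_obj j -> ir_obj j.+1};
    ir_aug : {linear N -> ir_obj 0};
    ir_inj : forall j, graded_injective (ir_obj j);
    ir_d_homog : forall j, homogeneous (ir_d j);
    ir_aug_homog : homogeneous ir_aug;
    ir_aug_inj : injective ir_aug;
    ir_exact0 : forall v, ir_d 0 v = 0 <-> exists u, v = ir_aug u;
    ir_exactS : forall j v, ir_d j.+1 v = 0 <-> exists u, v = ir_d j u
  }.

Arguments ir_obj {k n N} _ _.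
Arguments ir_d {k n N} _ _.

(* Cocycles and coboundaries of the complex [Gamma_B(I^0) -> Gamma_B(I^1) -> ...]. *)
Definition cocycle (k : fieldType) (n : nat) (B : {mpoly k[n]} -> Prop)
    (N : gmod k n) (E : injective_resolution N) (i : nat) (v : ir_obj E i) : Prop :=
  torsion B v /\ ir_d E i v = 0.

Definition coboundary (k : fieldType) (n : nat) (B : {mpoly k[n]} -> Prop)
    (N : gmod k n) (E : injective_resolution N) (i : nat) : ir_obj E i -> Prop :=
  if i is j.+1 then fun v => exists2 w, torsion B w & v = ir_d E j w
  else fun v => v = 0.

(* [H] is, up to isomorphism of graded modules, [H^i_B(N)]: the map [pi], of
   which only the values on cocycles matter, induces an isomorphism of degree
   [0] from cocycles modulo coboundaries onto [H]. *)
Definition is_local_cohomology (k : fieldType) (n : nat)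
    (B : {mpoly k[n]} -> Prop) (i : nat) (N H : gmod k n) : Prop :=
  exists (E : injective_resolution N) (pi : ir_obj E i -> H),
    [/\ forall a u v, cocycle B u -> cocycle B v ->
          pi (a *: u + v) = a *: pi u + pi v,
        forall p v, cocycle B v -> gm_deg (ir_obj E i) p v -> gm_deg H p (pi v),
        forall v, cocycle B v -> (pi v = 0 <-> coboundary B v) &
        forall h, exists2 v, cocycle B v & pi v = h].

(** * Coarser gradings and finiteness *)

(* [N_delta], the sum of the [N_p] over the [p] with [phi p = delta]. *)
Definition coarse_deg (k : fieldType) (n : nat) (D : zmodType)
    (phi : Zn n -> D) (N : gmod k n) (delta : D) (v : N) : Prop :=
  exists (s : seq (Zn n)) (f : Zn n -> N),
    [/\ forall p, p \in s -> phi p = delta,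
        forall p, gm_deg N p (f p) &
        v = \sum_(p <- s) f p].

(* [k] acts on an [S]-module through the constant polynomials [c%:MP]. *)
Definition finite_dim (k : fieldType) (n : nat) (N : gmod k n)
    (W : N -> Prop) : Prop :=
  exists (r : nat) (b : 'I_r -> N),
    (forall j, W (b j)) /\
    forall v, W v -> exists c : 'I_r -> k, v = \sum_(j < r) (c j)%:MP *: b j.

(* [Sigma_i], where [H] is [H^i_B(S)]. *)
Definition Sigma (k : fieldType) (n : nat) (H : gmod k n)
    (I : {set 'I_n}) : Prop :=
  forall p : Zn n, neg p = I -> exists2 v, gm_deg H p v & v <> 0.

(* Main.v *)
Require Import Defs.
From HB Require Import structures.
From mathcomp Require Import all_boot all_order all_algebra.
From mathcomp Require Import mpoly.
From mathcomp Require Import zify.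
From Stdlib Require Import Classical.

(** The two finiteness conditions are matched degree by degree. Write
    [H = H^i_B(S)]. Two facts about single degrees suffice: [H_p] is finite
    dimensional for every [p], and whether [H_p] vanishes depends only on
    [neg p]. Given these, [H_delta] is the direct sum of the [H_p] over the
    fibre [p0 + M] of [phi] above [delta], so it is finite dimensional exactly
    when only finitely many [q] in [p0 + M] have [H_q <> 0], that is, [neg q] in
    [Sigma]; as there are finitely many sets [I], this is the stated condition.

    Both facts come from one statement about the complex [Gamma_B(E)], where
    [E] is an injective resolution of [S]: multiplication by [X^m] is a
    quasi-isomorphism from its degree [p] part to its degree [p + deg m] part
    whenever [neg p = neg (p + deg m)] ([mulX_quasi_iso]). For [E] itself this
    is the same statement about [S], where it is obvious. The generators
    [m0, ..., mr] of [B] are then added one at a time, since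
    [Gamma_(B' + (m0)) = Gamma_(m0) Gamma_(B')]. Put [F = Gamma_(B')(E)] and
    [F' = Gamma_(m0)(F)]. If the cones of [X^m] on [F] and on [F / F'] are
    acyclic, then so is the cone on [F']. A cocycle of the cone on [F / F'] is
    turned into a cocycle of the cone on [F] by a high power of [m0], which
    moves [p] to [p + l deg m0] and so makes the coordinates in the support of
    [m0] nonnegative without changing the others. There it is the boundary of
    some chain; dividing this chain by the power of [m0] gives what is wanted
    in [F / F'] ([relative_quasi_iso], [quasi_iso_cons]).
    Finiteness passes from [F] to [F'] by the same device
    ([relative_cocycle_span], [finite_cohomology_cons]).

    The division needs that [F] is [m0]-divisible ([mono_torsion_divide]). An
    element [e] of [E] killed by the powers [u^l] of the generators [u] of [B']
    defines a map to [E] on the ideal generated by [m0] and the [u^(l+1)],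
    sending [m0] to [e] and each [u^(l+1)] to a multiple of [e] that vanishes;
    it is well defined because [m0] is square-free. It extends to [S] by
    injectivity, and the image of [1] is the quotient. *)

Set Implicit Arguments.
Unset Strict Implicit.
Unset Printing Implicit Defensive.

Import Order.TTheory GRing.Theory Num.Theory.

Local Open Scope ring_scope.

(** * Homogeneous components *)

Section Graded.
Variables (k : fieldType) (n : nat).
Local Notation S := {mpoly k[n]}.

Lemma mdegZ_inj : injective (@mdegZ n).
Proof.
move=> u1 u2 /rowP e; apply/mnmP => j.
by have := e j; rewrite !mxE => -[].
Qed.

Lemma mdegZD (u1 u2 : 'X_{1..n}) :
  mdegZ (u1 + u2)%MM = mdegZ u1 + mdegZ u2.
Proof. by apply/rowP => j; rewrite !mxE mnmDE PoszD. Qed.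

Lemma mdegZ0 : mdegZ (0%MM : 'X_{1..n}) = 0.
Proof. by apply/rowP => j; rewrite !mxE mnm0E. Qed.

Lemma Sdeg_mpolyX (u : 'X_{1..n}) : Sdeg (mdegZ u) ('X_[u] : S).
Proof. by move=> w; rewrite msuppX inE => /eqP ->. Qed.

Lemma Sdeg_mpolyC (c : k) : Sdeg 0 (c%:MP : S).
Proof.
move=> w; rewrite msuppC; case: ifP => // _; rewrite inE => /eqP ->.
exact: mdegZ0.
Qed.

Section Components.
Variable N : gmod k n.
Implicit Types (p q : Zn n) (v w : N).

Lemma gm_deg0 p : gm_deg N p 0.
Proof. exact: (grading_0 (gm_grading N)). Qed.

Lemma gm_degB p v w : gm_deg N p v -> gm_deg N p w -> gm_deg N p (v - w).
Proof. exact: (grading_B (gm_grading N)). Qed.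

Lemma gm_degN p v : gm_deg N p v -> gm_deg N p (- v).
Proof. by move=> hv; rewrite -sub0r; apply: gm_degB => //; apply: gm_deg0. Qed.

Lemma gm_degD p v w : gm_deg N p v -> gm_deg N p w -> gm_deg N p (v + w).
Proof. by move=> hv hw; rewrite -[w]opprK; exact: gm_degB hv (gm_degN hw). Qed.

Lemma gm_degX p (u : 'X_{1..n}) v :
  gm_deg N p v -> gm_deg N (p + mdegZ u) ('X_[u] *: v).
Proof.
move=> hv; rewrite addrC; have := (grading_Z (gm_grading N) (@Sdeg_mpolyX u) hv). exact.
Qed.

Lemma gm_degC p (c : k) v : gm_deg N p v -> gm_deg N p (c%:MP *: v).
Proof.
move=> hv; rewrite -[p]add0r.
exact: (grading_Z (gm_grading N) (@Sdeg_mpolyC c) hv).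
Qed.

(** No homogeneous component of [v] has degree [p]; the list form is closed
    under addition without any merging of terms of equal degree. *)
Definition off_degree p v := exists2 l : seq (Zn n * N),
  forall x, x \in l -> x.1 != p /\ gm_deg N x.1 x.2 & v = \sum_(x <- l) x.2.

Lemma off_degreeD p v w : off_degree p v -> off_degree p w -> off_degree p (v + w).
Proof.
move=> [l1 h1 ->] [l2 h2 ->]; exists (l1 ++ l2); last by rewrite big_cat.
by move=> x; rewrite mem_cat => /orP[/h1|/h2].
Qed.

Lemma off_degreeN p v : off_degree p v -> off_degree p (- v).
Proof.
move=> [l h ->]; exists [seq (x.1, - x.2) | x <- l].
  by move=> _ /mapP[x /h[h1 h2] ->]; split=> //=; apply: gm_degN.
by rewrite big_map sumrN.
Qed.

Lemma off_degree0 p : off_degree p 0.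
Proof. by exists [::]; rewrite ?big_nil. Qed.

Lemma off_degree_homog p q v : q != p -> gm_deg N q v -> off_degree p v.
Proof.
move=> ne hv; exists [:: (q, v)]; last by rewrite big_seq1.
by move=> x; rewrite inE => /eqP ->.
Qed.

Lemma off_degree_sum (I : eqType) (r : seq I) p (f : I -> N) :
  (forall x, x \in r -> off_degree p (f x)) -> off_degree p (\sum_(x <- r) f x).
Proof.
move=> h; rewrite big_seq; apply: big_ind => //; first exact: off_degree0.
exact: off_degreeD.
Qed.

Lemma gm_deg_sum (I : eqType) (r : seq I) (P : pred I) p (f : I -> N) :
  (forall x, x \in r -> P x -> gm_deg N p (f x)) ->
  gm_deg N p (\sum_(x <- r | P x) f x).
Proof.
move=> h; rewrite big_seq_cond; apply: big_ind; first exact: gm_deg0.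
  exact: gm_degD.
by move=> x /andP[]; apply: h.
Qed.

(** The elements of the list that have the same degree are added up, because
    the independence clause of a grading is about distinct degrees. *)
Lemma off_degree_eq0 p v : gm_deg N p v -> off_degree p v -> v = 0.
Proof.
move=> hv [l hl ev].
pose f q := if q == p then - v else \sum_(x <- l | x.1 == q) x.2.
pose s := undup [seq x.1 | x <- l].
have ps : p \notin s.
  by rewrite mem_undup; apply/mapP => -[x /hl[/eqP ne _] e]; apply: ne.
have fN : forall q, gm_deg N q (f q).
  move=> q; rewrite /f; case: eqP => [->|_]; first exact: gm_degN.
  by apply: gm_deg_sum => x /hl[_ h] /eqP <-.
have us : uniq (p :: s) by rewrite /= ps undup_uniq.
have h0 : \sum_(q <- p :: s) f q = 0.
  rewrite big_cons {1}/f eqxx.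
  have -> : \sum_(q <- s) f q = \sum_(q <- s) \sum_(x <- l | x.1 == q) x.2.
    apply: eq_big_seq => q qs; rewrite /f; case: eqP => // e.
    by rewrite -e qs in ps.
  rewrite (exchange_big_dep xpredT) //= [X in _ + X](_ : _ = v) ?addNr // ev.
  apply: eq_big_seq => x xl.
  rewrite (eq_bigl (pred1 x.1)); last by move=> q /=; rewrite eq_sym.
  by rewrite -big_filter filter_pred1_uniq ?undup_uniq ?big_seq1 // mem_undup map_f.
have := grading_indep (gm_grading N) us fN h0 (mem_head p s).
by rewrite /f eqxx => /eqP; rewrite oppr_eq0 => /eqP.
Qed.

Definition component p v w := gm_deg N p w /\ off_degree p (v - w).

Lemma component_homog p v : gm_deg N p v -> component p v v.
Proof. by move=> hv; split; rewrite ?subrr //; apply: off_degree0. Qed.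

Lemma component_uniq p v w1 w2 : component p v w1 -> component p v w2 -> w1 = w2.
Proof.
move=> [h1 o1] [h2 o2]; apply/eqP; rewrite -subr_eq0; apply/eqP.
apply: (@off_degree_eq0 p); first exact: gm_degB.
have -> : w1 - w2 = - (v - w1) + (v - w2) by rewrite opprB addrA subrK.
by apply: off_degreeD => //; apply: off_degreeN.
Qed.

Lemma component_exists p v : exists w, component p v w.
Proof.
have [s [f [us hf ->]]] := grading_span (gm_grading N) v.
exists (\sum_(q <- s | q == p) f q); split.
  by apply: gm_deg_sum => q _ /eqP <-.
rewrite (bigID (fun q => q == p)) /= addrAC subrr add0r -big_filter.
apply: off_degree_sum => q; rewrite mem_filter => /andP[ne _].
exact: off_degree_homog ne (hf q).
Qed.

End Components.

(** The one principle by which statements on arbitrary elements are reduced to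
    homogeneous ones: it covers the differentials ([a = 0]) and multiplication
    by a monomial. *)
Lemma component_map (A C : gmod k n) (a : Zn n) (g : A -> C) p v w :
  (forall x y, g (x - y) = g x - g y) ->
  (forall q x, gm_deg A q x -> gm_deg C (q + a) (g x)) ->
  component p v w -> component (p + a) (g v) (g w).
Proof.
move=> gB ga [hw [l hl e]]; split; first exact: ga.
have g0 : g 0 = 0 by rewrite -{1}(subrr 0) gB subrr.
have gD x y : g (x + y) = g x + g y.
  have gN z : g (- z) = - g z by rewrite -sub0r gB g0 sub0r.
  by rewrite -{1}[y]opprK gB gN opprK.
rewrite -gB e (big_morph g gD g0); apply: off_degree_sum => x /hl[ne hx].
apply: off_degree_homog (ga _ _ hx); apply: contra ne => /eqP /addIr ->.
exact: eqxx.
Qed.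

Lemma component_linear (A C : gmod k n) (f : {linear A -> C}) p v w :
  homogeneous f -> component p v w -> component p (f v) (f w).
Proof.
move=> hf; rewrite -{2}[p]addr0; apply: component_map => [x y|q x].
  exact: linearB.
by rewrite addr0; apply: hf.
Qed.

Lemma component_mulX (A : gmod k n) (u : 'X_{1..n}) p (v w : A) :
  component p v w -> component (p + mdegZ u) ('X_[u] *: v) ('X_[u] *: w).
Proof.
apply: component_map => [x y|q x]; first exact: scalerBr.
exact: gm_degX.
Qed.

End Graded.

(** * Shifts and monomial ideals as graded modules *)

Section Shift.
Variables (k : fieldType) (n : nat) (N : gmod k n) (a : Zn n).

Lemma shift_grading : @is_grading k n N (fun q v => gm_deg N (q - a) v).
Proof.
split.
- by move=> q; apply: gm_deg0.
- by move=> q u v; apply: gm_degB.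
- move=> p q c v hc hv; rewrite -addrA.
  exact: (grading_Z (gm_grading N) hc hv).
- move=> v; have [s [f [us hf ->]]] := grading_span (gm_grading N) v.
  exists [seq q + a | q <- s], (fun q => f (q - a)); split=> //.
    by rewrite map_inj_uniq //; apply: addIr.
  by rewrite big_map; apply: eq_bigr => q _; rewrite addrK.
- move=> s f us hf h0 q qs.
  have us' : uniq [seq q - a | q <- s] by rewrite map_inj_uniq //; apply: addIr.
  have hf' p : gm_deg N p (f (p + a)) by have := hf (p + a); rewrite addrK.
  have h0' : \sum_(p <- [seq q - a | q <- s]) f (p + a) = 0.
    by rewrite big_map -[RHS]h0; apply: eq_bigr => p _; rewrite subrK.
  have := grading_indep (gm_grading N) us' hf' h0' (map_f _ qs).
  by rewrite subrK.
Qed.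

Definition gmod_shift : gmod k n := GMod shift_grading.

End Shift.

Section MonomialIdeal.
Variables (k : fieldType) (n : nat).
Local Notation S := {mpoly k[n]}.

Definition in_monomial_ideal (M : seq 'X_{1..n}) (w : 'X_{1..n}) : bool :=
  has (fun g => (g <= w)%MM) M.

Definition monomial_ideal (M : seq 'X_{1..n}) : {pred S^o} :=
  fun f : S => all (in_monomial_ideal M) (msupp f).

Lemma in_monomial_idealD M (w w' : 'X_{1..n}) :
  in_monomial_ideal M w -> in_monomial_ideal M (w' + w)%MM.
Proof.
by move=> /hasP[g gM gw]; apply/hasP; exists g => //; apply: lepm_trans gw (lem_addl _ _).
Qed.

Lemma monomial_idealX M u : ('X_[u] : S) \in monomial_ideal M = in_monomial_ideal M u.
Proof. by rewrite unfold_in /monomial_ideal msuppX /= andbT. Qed.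

Fact monomial_ideal_submod M : submod_closed (monomial_ideal M).
Proof.
split; first by rewrite unfold_in /monomial_ideal msupp0.
move=> a f g hf hg; apply/allP => w /msuppD_le; rewrite mem_cat.
case/orP => [|/(allP hg)//].
move=> /msuppM_le /allpairsP[[w1 w2] /= [_ h2 ->]].
exact: in_monomial_idealD (allP hf _ h2).
Qed.

HB.instance Definition _ M :=
  GRing.isSubmodClosed.Build S S^o (monomial_ideal M) (monomial_ideal_submod M).

Record ideal_of M := IdealOf {
  ideal_val :> S^o;
  ideal_valP : ideal_val \in monomial_ideal M }.

HB.instance Definition _ M := [isSub of ideal_of M for @ideal_val M].
HB.instance Definition _ M := [Choice of ideal_of M by <:].
HB.instance Definition _ M := [SubChoice_isSubLmodule of ideal_of M by <:].

Lemma ideal_grading M :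
  @is_grading k n (ideal_of M) (fun q f => Sdeg q (val f)).
Proof.
split.
- by move=> q; rewrite raddf0; apply: (grading_0 (Sdeg_grading k n)).
- by move=> q u v hu hv; rewrite raddfB; apply: (grading_B (Sdeg_grading k n)).
- by move=> p q a v ha hv; rewrite linearZ; apply: (grading_Z (Sdeg_grading k n)).
- move=> v; have [s [f [us hf e]]] := grading_span (Sdeg_grading k n) (val v).
  have fI q : (if q \in s then f q else 0) \in monomial_ideal M.
    case: ifP => [qs|_]; last exact: rpred0.
    apply/allP => w wf; apply: (allP (ideal_valP v)).
    have dw := hf q _ wf.
    rewrite mcoeff_msupp [ideal_val v]e raddf_sum /= (bigD1_seq q) //=.
    rewrite big1 ?addr0 -?mcoeff_msupp // => q' ne; apply: memN_msupp_eq0.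
    by apply: contra ne => /hf <-; rewrite dw.
  exists s, (fun q => IdealOf (fI q)); split=> //= [q|].
    by case: ifP => _; [apply: hf | apply: (grading_0 (Sdeg_grading k n))].
  apply: val_inj; rewrite raddf_sum /= [LHS]e.
  by apply: eq_big_seq => q ->.
- move=> s f us hf h0 q qs; apply: val_inj; rewrite raddf0.
  apply: (grading_indep (Sdeg_grading k n) us (f := fun q => val (f q))) => //.
  by have := congr1 val h0; rewrite raddf_sum raddf0.
Qed.

Definition ideal_gmod M : gmod k n := GMod (ideal_grading M).

(** Division by [X^m] that drops the monomials which [X^m] does not divide:
    this keeps it [k]-linear on all of [S], and it is [S]-linear modulo the
    annihilator of a suitable element ([divX_mul]). *)
Definition divX (m : 'X_{1..n}) (f : S) : S :=
  \sum_(w <- msupp f | (m <= w)%MM) f@_w *: 'X_[w - m].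

Lemma mcoeff_divX m f w : (divX m f)@_w = f@_(m + w).
Proof.
rewrite /divX raddf_sum /=.
have [h|h] := boolP (m + w \in msupp f)%MM; last first.
  rewrite (memN_msupp_eq0 h) big_seq_cond big1 // => u /andP[uf mu].
  rewrite mcoeffZ mcoeffX; case: eqP => [e|]; last by rewrite mulr0.
  by rewrite -e addmC submK // uf in h.
rewrite -big_filter (bigD1_seq (m + w)%MM) ?filter_uniq ?msupp_uniq //=; last first.
  by rewrite mem_filter lem_addr.
rewrite big_filter_cond.
rewrite mcoeffZ mcoeffX [in (_ - m)%MM]addmC addmK eqxx mulr1 big1 ?addr0 //.
move=> u /andP[mu ne]; rewrite mcoeffZ mcoeffX; case: eqP => [e|]; last by rewrite mulr0.
by rewrite -e addmC submK ?eqxx // in ne.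
Qed.

Lemma divXD m f g : divX m (f + g) = divX m f + divX m g.
Proof. by apply/mpolyP => w; rewrite mcoeffD !mcoeff_divX mcoeffD. Qed.

Lemma divXZ m c f : divX m (c *: f) = c *: divX m f.
Proof. by apply/mpolyP => w; rewrite mcoeffZ !mcoeff_divX mcoeffZ. Qed.

Lemma divX0 m : divX m 0 = 0.
Proof. by apply/mpolyP => w; rewrite mcoeff_divX !mcoeff0. Qed.

Lemma divX_sum m (I : Type) (r : seq I) (F : I -> S) :
  divX m (\sum_(i <- r) F i) = \sum_(i <- r) divX m (F i).
Proof. exact: (big_morph _ (divXD m) (divX0 m)). Qed.

Lemma divX_mpolyX m w : divX m 'X_[w] = if (m <= w)%MM then 'X_[w - m] else 0.
Proof.
apply/mpolyP => u; rewrite mcoeff_divX mcoeffX.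
case: ifP => mw.
  rewrite mcoeffX; congr (_%:R); congr (nat_of_bool _).
  by rewrite -[in LHS](submK mw) addmC eqm_add2l.
rewrite mcoeff0; case: eqP => // e.
by rewrite e lem_addr in mw.
Qed.

End MonomialIdeal.

(** * Torsion along monomials, and divisibility of torsion in injectives *)

Section MonomialTorsion.
Variables (k : fieldType) (n : nat).
Local Notation S := {mpoly k[n]}.

(** [Gamma_B] when [B] is generated by the monomials in [G]; in this form
    adding a generator is an intersection ([mono_torsion_cons]). *)
Definition mono_torsion (G : seq 'X_{1..n}) (V : lmodType S) (v : V) : Prop :=
  exists l : nat, forall u, u \in G -> 'X_[u *+ l] *: v = 0.

Lemma mulmDn (u : 'X_{1..n}) l1 l2 : (u *+ (l1 + l2) = u *+ l1 + u *+ l2)%MM.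
Proof. by apply/mnmP => j; rewrite mnmDE !mulmnE mulnDr. Qed.

Lemma mulX_scale (V : lmodType S) u1 u2 (v : V) :
  'X_[u1 + u2] *: v = 'X_[u1] *: ('X_[u2] *: v).
Proof. by rewrite scalerA mpolyXD. Qed.

Lemma killX_le (V : lmodType S) u l1 l2 (v : V) : (l1 <= l2)%N ->
  'X_[u *+ l1] *: v = 0 -> 'X_[u *+ l2] *: v = 0.
Proof. by move=> h e; rewrite -(subnK h) mulmDn mulX_scale e scaler0. Qed.

Section Torsion.
Variables (G : seq 'X_{1..n}) (V : lmodType S).
Implicit Types v w : V.

Lemma mono_torsion0 : mono_torsion G (0 : V).
Proof. by exists 0%N => u _; rewrite scaler0. Qed.

Lemma mono_torsionB v w :
  mono_torsion G v -> mono_torsion G w -> mono_torsion G (v - w).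
Proof.
move=> [l1 h1] [l2 h2]; exists (maxn l1 l2) => u uG.
rewrite scalerBr (killX_le (leq_maxl _ _) (h1 u uG)).
by rewrite (killX_le (leq_maxr _ _) (h2 u uG)) subrr.
Qed.

Lemma mono_torsionZ a v : mono_torsion G v -> mono_torsion G (a *: v).
Proof.
by move=> [l h]; exists l => u /h e; rewrite scalerA mulrC -scalerA e scaler0.
Qed.

Lemma mono_torsionD v w :
  mono_torsion G v -> mono_torsion G w -> mono_torsion G (v + w).
Proof.
move=> hv hw; rewrite -[w]opprK; apply: mono_torsionB => //.
by rewrite -scaleN1r; apply: mono_torsionZ.
Qed.

Lemma mono_torsion_cons u v :
  mono_torsion (u :: G) v <->
  (exists l, 'X_[u *+ l] *: v = 0) /\ mono_torsion G v.
Proof.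
split=> [[l h]|[[l1 h1] [l2 h2]]].
  split; first by exists l; apply: h; rewrite mem_head.
  by exists l => w wG; apply: h; rewrite inE wG orbT.
exists (maxn l1 l2) => w; rewrite inE => /orP[/eqP ->|/h2].
  exact: killX_le (leq_maxl _ _) h1.
exact: killX_le (leq_maxr _ _).
Qed.

End Torsion.

Lemma mono_torsion_linear G (V W : lmodType S) (f : {linear V -> W}) v :
  mono_torsion G v -> mono_torsion G (f v).
Proof. by move=> [l h]; exists l => u /h e; rewrite -linearZ e linear0. Qed.

(** Monomials are homogeneous, so torsion passes to components. *)
Lemma mono_torsion_component G (N : gmod k n) p (v w : N) :
  component p v w -> mono_torsion G v -> mono_torsion G w.
Proof.
move=> c [l h]; exists l => u /h e.
have := component_mulX (u *+ l)%MM c; rewrite e => c'.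
apply: component_uniq c' _; apply: component_homog; exact: gm_deg0.
Qed.

Section Divide.
Variables (G : seq 'X_{1..n}) (m : 'X_{1..n}) (l : nat).
Let M := m :: [seq (u *+ l.+1)%MM | u <- G].
Hypothesis msqf : squarefree m.

(** The rule [f |-> (f / X^m) e] is well defined and [S]-linear on the ideal
    generated by [X^m] and the [u^(l+1)]: a multiple of [u^(l+1)] that is
    divisible by [X^m] has its quotient divisible by [u^l], as [m] is
    square-free, and so acts by [0] on [e]. *)
Lemma divX_mul (V : lmodType S) (e : V) (b f : S) :
  (forall u, u \in G -> 'X_[u *+ l] *: e = 0) ->
  (f : S^o) \in monomial_ideal M ->
  divX m (b * f) *: e = (b * divX m f) *: e.
Proof.
move=> he hf.
rewrite [f in LHS]mpolyE [f in RHS]mpolyE mulr_sumr !divX_sum mulr_sumr !scaler_suml.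
apply: eq_big_seq => w /(allP hf) wM; rewrite -scalerAr !divXZ -scalerAr.
rewrite -!mul_mpolyC -!scalerA; congr (_ *: _).
rewrite [divX m _ in RHS]divX_mpolyX [b in LHS]mpolyE [b in RHS]mpolyE !mulr_suml divX_sum !scaler_suml.
apply: eq_bigr => w' _; rewrite -!scalerAl divXZ -!mul_mpolyC -!scalerA.
congr (_ *: _); rewrite -mpolyXD divX_mpolyX.
have [mw|mw] := boolP (m <= w)%MM.
  rewrite (lepm_trans mw (lem_addl _ _)) scalerA -mpolyXD; congr ('X_[_] *: _).
  by rewrite addmBA.
move: wM; rewrite /in_monomial_ideal /= (negbTE mw) /= => /hasP[_ /mapP[u uG ->] uw].
rewrite scale0r scaler0; case: ifP => [mw'|_]; last by rewrite scale0r.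
have le : (u *+ l <= w' + w - m)%MM.
  apply/mnm_lepP => j; move/mnm_lepP: uw => /(_ j).
  rewrite mnmBE mnmDE !mulmnE.
  have := forallP msqf j; move/mnm_lepP: mw' => /(_ j); rewrite mnmDE.
  nia.
by rewrite -(submK le) mulX_scale he // scaler0.
Qed.

(** The map [f |-> (f / X^m) e] is extended from the ideal to [S], and the
    quotient is the image of [1]. Both modules are shifted by
    [a = p - deg m], which puts [X^m] in degree [p], the degree of [e], and
    makes the map homogeneous. The exponent [l] grows by one because the
    quotient is killed by the [u^(l+1)] only. *)
Lemma divide_homog (E : gmod k n) p (e : E) : graded_injective E ->
  gm_deg E p e -> (forall u, u \in G -> 'X_[u *+ l] *: e = 0) ->
  exists e' : E, [/\ gm_deg E (p - mdegZ m) e',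
     forall u, u \in G -> 'X_[u *+ l.+1] *: e' = 0 & 'X_[m] *: e' = e].
Proof.
move=> Einj he hk.
pose a : Zn n := p - mdegZ m.
pose gf (f : gmod_shift (@ideal_gmod k n M) a) : E := divX m (ideal_val f) *: e.
have gl : linear gf.
  move=> b f1 f2; rewrite /gf /= divXD scalerDl; congr (_ + _).
  by rewrite scalerA; apply: divX_mul hk (ideal_valP f1).
pose g : {linear gmod_shift (@ideal_gmod k n M) a -> E} :=
  HB.pack gf (GRing.isLinear.Build _ _ _ _ gf gl).
pose inc : {linear gmod_shift (@ideal_gmod k n M) a -> gmod_shift (Sgmod k n) a} :=
  (val : {linear ideal_of k M -> S^o}).
have inc_hom : homogeneous inc by [].
have g_hom : homogeneous g.
  move=> q f hf.
  have hd : Sdeg (q - p) (divX m (ideal_val f)).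
    move=> w; rewrite mcoeff_msupp mcoeff_divX -mcoeff_msupp => /hf.
    rewrite mdegZD => e'; apply: (addrI (mdegZ m)); rewrite e'.
    rewrite /a opprB addrCA; congr (_ + _); exact: addrC.
  have := grading_Z (gm_grading E) hd he.
  by rewrite subrK.
have [h h_hom hE] := Einj _ _ inc g inc_hom g_hom val_inj.
have hX (u : 'X_{1..n}) : in_monomial_ideal M u ->
    'X_[u] *: h (1 : S) = divX m 'X_[u] *: e.
  move=> uM; rewrite -linearZ.
  have uM' : ('X_[u] : S^o) \in monomial_ideal M by rewrite monomial_idealX.
  by rewrite -[RHS](hE (IdealOf uM')) /= /GRing.scale /= mulr1.
exists (h (1 : S)); split.
- apply: h_hom; rewrite /= subrr -mpolyC1; exact: Sdeg_mpolyC.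
- move=> u uG; rewrite hX; last first.
    apply/hasP; exists (u *+ l.+1)%MM; last exact: lepm_refl.
    by rewrite inE; apply/orP; right; apply/mapP; exists u.
  rewrite divX_mpolyX; case: ifP => [mu|_]; last exact: scale0r.
  have le : (u *+ l <= u *+ l.+1 - m)%MM.
    apply/mnm_lepP => j; rewrite mnmBE !mulmnE.
    have := forallP msqf j; move/mnm_lepP: mu => /(_ j); rewrite mulmnE.
    nia.
  by rewrite -(submK le) mulX_scale hk // scaler0.
- rewrite hX; last by rewrite /in_monomial_ideal /= lepm_refl.
  rewrite divX_mpolyX lepm_refl.
  have -> : (m - m)%MM = 0%MM :> 'X_{1..n} by apply/mnmP => j; rewrite mnmBE subnn mnm0E.
  by rewrite mpolyX0 scale1r.
Qed.
End Divide.

Lemma mono_torsion_divide G m l (E : gmod k n) p (e : E) :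
  squarefree m -> graded_injective E ->
  gm_deg E (p + mdegZ (m *+ l)%MM) e -> mono_torsion G e ->
  exists e' : E, [/\ gm_deg E p e', mono_torsion G e' & 'X_[m *+ l] *: e' = e].
Proof.
move=> msqf Einj; elim: l p e => [|l IH] p e he te.
  by exists e; rewrite mulm0n mdegZ0 addr0 in he *; rewrite mpolyX0 scale1r.
move: he; rewrite mulmS mdegZD addrA => he.
have [e1 [he1 te1 <-]] := IH _ _ he te.
have [l1 k1] := te1.
have [e2 [he2 k2 <-]] := divide_homog msqf Einj he1 k1.
exists e2; split; last by rewrite [(m + _)%MM]addmC mulX_scale.
  by rewrite addrK in he2.
by exists l1.+1.
Qed.

End MonomialTorsion.

(** * Finite dimension modulo a subspace *)

Section SpanModulo.
Variables (k : fieldType) (n : nat).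
Local Notation S := {mpoly k[n]}.

Section OneModule.
Variable V : lmodType S.
Implicit Types (u v w : V) (bs : seq V) (P Q W : V -> Prop).

Definition ksubspace P :=
  P 0 /\ forall (c : k) u v, P u -> P v -> P (u - c%:MP *: v).

(** [v] lies in the [k]-span of [bs] modulo [P]. The recursive form makes
    changes of [bs] and of [P] plain inductions. *)
Fixpoint kspan bs P v : Prop :=
  if bs is b :: bs' then exists c : k, kspan bs' P (v - c%:MP *: b) else P v.

Definition fin_quotient W P :=
  exists2 bs, forall b, b \in bs -> W b & forall v, W v -> kspan bs P v.

Lemma kspan_ksubspace bs P : ksubspace P -> ksubspace (kspan bs P).
Proof.
move=> hP; elim: bs => [|b bs [IH0 IH]] //=; split.
  by exists 0; rewrite mpolyC0 scale0r subr0.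
move=> c u v [cu hu] [cv hv]; exists (cu - c * cv).
have -> : u - c%:MP *: v - (cu - c * cv)%:MP *: b =
    (u - cu%:MP *: b) - c%:MP *: (v - cv%:MP *: b); last exact: IH.
rewrite mpolyCB mpolyCM scalerBl scalerBr scalerA !opprB addrACA [RHS]addrACA.
by congr (_ + _); apply: addrC.
Qed.

Lemma kspan_trans bs bs' P Q v :
  (forall w, P w -> kspan bs' Q w) -> kspan bs P v -> kspan (bs ++ bs') Q v.
Proof.
move=> h; elim: bs v => [|b bs IH] v /=; first exact: h.
by move=> [c /IH hc]; exists c.
Qed.

(** A subspace of a finite-dimensional quotient is finite dimensional: either
    some [w] in [W] involves the first spanning vector [b], and then [w]
    replaces [b], or [b] is superfluous for [W]. *)
Lemma kspan_sub bs W P : ksubspace W -> ksubspace P ->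
  (forall v, W v -> kspan bs P v) -> fin_quotient W (fun v => P v /\ W v).
Proof.
move=> + hP; elim: bs W => [|b bs IH] W hW h.
  by exists [::] => // v Wv; split=> //; apply: h.
have [hX0 hXB] := kspan_ksubspace bs hP.
have [[w [c [Ww c0 hw]]]|no] :=
    classic (exists w c, [/\ W w, c != 0 & kspan bs P (w - c%:MP *: b)]).
  pose W' v := W v /\ kspan bs P v.
  have hW' : ksubspace W'.
    split; first by split => //; apply: hW.1.
    by move=> a u v [u1 u2] [v1 v2]; split; [apply: hW.2 | apply: hXB].
  have [bs' bsW hbs] := IH W' hW' (fun v => @proj2 _ _).
  exists (w :: bs') => [x|v Wv].
    by rewrite inE => /orP[/eqP ->|/bsW[]].
  have [c' hc'] := h _ Wv; exists (c' / c).
  have hv' : W' (v - (c' / c)%:MP *: w).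
    split; first exact: hW.2.
    have := hXB (c' / c) _ _ hc' hw.
    by rewrite scalerBr scalerA -mpolyCM divfK // opprB addrA subrK.
  have := hbs _ hv'; rewrite -[bs' in X in _ -> X]cats0.
  by apply: kspan_trans => x [xP [xW _]].
apply: (IH W hW) => v Wv; have [c hc] := h _ Wv.
have [c0|c0] := eqVneq c 0; last by case: no; exists v, c.
by move: hc; rewrite c0 mpolyC0 scale0r subr0.
Qed.

Lemma kspan0_sum bs v : kspan bs (eq^~ 0) v ->
  exists c : 'I_(size bs) -> k, v = \sum_(j < size bs) (c j)%:MP *: bs`_j.
Proof.
elim: bs v => [|b bs IH] v /=.
  by move=> ->; exists (fun=> 0); rewrite big_ord0.
move=> [c0 /IH[c hc]].
exists (fun j => if unlift ord0 j is Some j' then c j' else c0).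
rewrite big_ord_recl unlift_none /=; apply/eqP; rewrite -subr_eq0 opprD addrA subr_eq0.
by apply/eqP; rewrite hc; apply: eq_bigr => j _; rewrite liftK.
Qed.

End OneModule.

(** A finite span is pulled back along a relation [R] between [V] and [V'],
    for instance one that holds between an element and some multiple of it up
    to boundaries, when no linear map relates the two sides. *)
Lemma kspan_transfer (V V' : lmodType S) (g : V -> V') (R : V -> V' -> Prop)
    (P : V' -> Prop) (Q : V -> Prop) bs y z :
  (forall b c y z, b \in bs -> R y z ->
     R (y - c%:MP *: b) (z - c%:MP *: g b)) ->
  (forall y z, R y z -> P z -> Q y) ->
  R y z -> kspan [seq g b | b <- bs] P z -> kspan bs Q y.
Proof.
move=> + hQ; elim: bs y z => [|b bs IH] y z hR Ryz /=; first exact: hQ.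
move=> [c hc]; exists c; apply: IH hc; last by apply: hR => //; apply: mem_head.
by move=> b' c' y' z' b'bs; apply: hR; rewrite inE b'bs orbT.
Qed.

Lemma preimage_seq (V V' : eqType) (g : V -> V') (W : V -> Prop) (bs : seq V') :
  (forall b, b \in bs -> exists2 x, W x & g x = b) ->
  exists2 xs, forall x, x \in xs -> W x & bs = [seq g x | x <- xs].
Proof.
elim: bs => [|b bs IH] h; first by exists [::].
have [x Wx <-] := h b (mem_head _ _).
have [c cs|xs xsW ->] := IH; first by apply: h; rewrite inE cs orbT.
by exists (x :: xs) => // z; rewrite inE => /orP[/eqP ->|/xsW].
Qed.

End SpanModulo.

(** * Torsion subcomplexes of a complex of injectives *)

Section Neg.
Variable n : nat.
Implicit Types (p q : Zn n) (m : 'X_{1..n}).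

Lemma neg_eqP p q :
  neg p = neg q <-> forall j, (p ord0 j < 0) = (q ord0 j < 0).
Proof.
split=> [e j|e]; last by apply/setP => j; rewrite !inE e.
by have := congr1 (fun A : {set 'I_n} => j \in A) e; rewrite /neg !inE.
Qed.

(** Far out in the direction of [m], all coordinates in the support of [m] are
    nonnegative and the other ones are as before. *)
Lemma eventually_nonneg p m : exists l0, forall l, (l0 <= l)%N ->
  forall j, m j != 0%N -> 0 <= (p + mdegZ (m *+ l)%MM) ord0 j.
Proof.
exists (\max_(j < n) `|p ord0 j|)%N => l hl j mj.
have := leq_trans (leq_bigmax j) hl; rewrite !mxE mulmnE.
by move: mj; set x := p ord0 j; set y := m j; nia.
Qed.

Lemma eventually_neg_eq p m m' : neg p = neg (p + mdegZ m') -> exists l0, forall l, (l0 <= l)%N ->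
  neg (p + mdegZ (m *+ l)%MM) = neg (p + mdegZ (m *+ l)%MM + mdegZ m').
Proof.
move=> /neg_eqP e; have [l0 h] := eventually_nonneg p m; exists l0 => l /h hl.
apply/neg_eqP => j; have := e j; have := hl j; rewrite !mxE mulmnE.
set x := p ord0 j; set y := m j; set z := m' j.
by have [->|y0] := eqVneq y 0%N; [rewrite mul0n addr0 | lia].
Qed.

Lemma eventually_neg_stable p m : exists l0, forall t,
  neg (p + mdegZ (m *+ l0)%MM) = neg (p + mdegZ (m *+ l0)%MM + mdegZ (m *+ t)%MM).
Proof.
have [l0 h] := eventually_nonneg p m; exists l0 => t.
apply/neg_eqP => j; have := h l0 (leqnn _) j; rewrite !mxE !mulmnE.
set x := p ord0 j; set y := m j.
by have [->|y0] := eqVneq y 0%N; [rewrite !mul0n !addr0 | lia].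
Qed.

End Neg.

Record injective_complex (k : fieldType) (n : nat) := InjectiveComplex {
  ic_obj :> nat -> gmod k n;
  ic_d : forall i, {linear ic_obj i -> ic_obj i.+1};
  ic_inj : forall i, graded_injective (ic_obj i);
  ic_homog : forall i, homogeneous (ic_d i);
  ic_dd : forall i v, ic_d i.+1 (ic_d i v) = 0 }.

Section TorsionSubcomplex.
Variables (k : fieldType) (n : nat) (C : injective_complex k n).
Local Notation d := (ic_d C _).

(** The degree [p] part of [Gamma_G(C^i)]. *)
Definition Gam (G : seq 'X_{1..n}) i (p : Zn n) (v : C i) : Prop :=
  gm_deg (C i) p v /\ mono_torsion G v.

Definition Gam_cocycle G i p (v : C i) : Prop := Gam G p v /\ d v = 0.
Definition Gam_coboundary G i p (v : C i.+1) : Prop :=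
  exists2 y : C i, Gam G p y & v = d y.

Section Closure.
Variables (G : seq 'X_{1..n}) (i : nat) (p : Zn n).
Implicit Types v w : C i.

Lemma Gam0 : Gam G p (0 : C i).
Proof. by split; [apply: gm_deg0 | apply: mono_torsion0]. Qed.

Lemma GamB v w : Gam G p v -> Gam G p w -> Gam G p (v - w).
Proof.
by move=> [v1 v2] [w1 w2]; split; [apply: gm_degB | apply: mono_torsionB].
Qed.

Lemma GamD v w : Gam G p v -> Gam G p w -> Gam G p (v + w).
Proof.
by move=> [v1 v2] [w1 w2]; split; [apply: gm_degD | apply: mono_torsionD].
Qed.

Lemma GamN v : Gam G p v -> Gam G p (- v).
Proof. by move=> hv; rewrite -sub0r; apply: GamB => //; apply: Gam0. Qed.

Lemma GamC (c : k) v : Gam G p v -> Gam G p (c%:MP *: v).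
Proof.
by move=> [v1 v2]; split; [apply: gm_degC | apply: mono_torsionZ].
Qed.

Lemma GamX (u : 'X_{1..n}) v : Gam G p v -> Gam G (p + mdegZ u) ('X_[u] *: v).
Proof.
by move=> [v1 v2]; split; [apply: gm_degX | apply: mono_torsionZ].
Qed.

Lemma Gam_d v : Gam G p v -> Gam G p (d v).
Proof.
move=> [v1 v2]; split; last exact: mono_torsion_linear.
exact: (@ic_homog _ _ C).
Qed.

Lemma Gam_divide (m : 'X_{1..n}) l v : squarefree m ->
  Gam G (p + mdegZ (m *+ l)%MM) v -> exists2 w, Gam G p w & 'X_[m *+ l] *: w = v.
Proof.
move=> msqf [v1 v2].
have [w [w1 w2 w3]] := mono_torsion_divide msqf (@ic_inj _ _ C i) v1 v2.
by exists w.
Qed.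

End Closure.

Lemma dX i (u : 'X_{1..n}) (v : C i) : d ('X_[u] *: v) = 'X_[u] *: d v.
Proof. exact: linearZ. Qed.

Definition Xpower_torsion (m : 'X_{1..n}) i (v : C i) :=
  exists l, 'X_[m *+ l] *: v = 0.

Lemma Gam_cons m G i p (v : C i) :
  Gam (m :: G) p v <-> Xpower_torsion m v /\ Gam G p v.
Proof.
by split=> [[h /mono_torsion_cons[]]|[h1 [h2 h3]]] //; split=> //;
   apply/mono_torsion_cons.
Qed.

Lemma common_power m i i' (v : C i) (w : C i') l0 :
  Xpower_torsion m v -> Xpower_torsion m w ->
  exists l, [/\ (l0 <= l)%N, 'X_[m *+ l] *: v = 0 & 'X_[m *+ l] *: w = 0].
Proof.
move=> [l1 h1] [l2 h2]; exists (maxn l0 (maxn l1 l2)); split.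
- exact: leq_maxl.
- by apply: killX_le h1; rewrite !leq_max leqnn !orbT.
- by apply: killX_le h2; rewrite !leq_max leqnn !orbT.
Qed.

(** Multiplication by [X^m] is a quasi-isomorphism between the degree [p] and
    the degree [p + deg m] parts of [Gamma_G(C)], expressed as acyclicity of its
    mapping cone: [(v, w)] is a cocycle of the cone, [(y, u)] a cochain with
    boundary [(v, w)]. The equation [v = d y] is injectivity on
    cohomology, and the case [v = 0] is surjectivity. The indices start at [2] and [1]; the
    complexes of interest begin with two zero modules. *)
Definition mulX_quasi_iso G :=
  forall p m, neg p = neg (p + mdegZ m) ->
  forall i (v : C i.+2) (w : C i.+1),
    Gam G p v -> Gam G (p + mdegZ m) w -> d v = 0 -> 'X_[m] *: v = d w ->
  exists (y : C i.+1) (u : C i), [/\ Gam G p y, Gam G (p + mdegZ m) u,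
    v = d y & w = 'X_[m] *: y + d u].

(** Acyclicity of the cone for the quotient of [Gamma_G(C)] by its
    [m0]-torsion, where an element is zero once a power of [m0] kills it. After
    multiplication by [m0^l] the pair [(v, w)] is a cocycle of the cone for
    [Gamma_G(C)] itself; [m0]-divisibility brings the cochain that bounds it
    back to degree [p]. *)
Lemma relative_quasi_iso G m0 p m i (v : C i.+2) (w : C i.+1) :
  squarefree m0 -> mulX_quasi_iso G -> neg p = neg (p + mdegZ m) ->
  Gam G p v -> Gam G (p + mdegZ m) w ->
  Xpower_torsion m0 (d v) -> Xpower_torsion m0 ('X_[m] *: v - d w) ->
  exists (y : C i.+1) (u : C i), [/\ Gam G p y, Gam G (p + mdegZ m) u,
    Xpower_torsion m0 (v - d y) & Xpower_torsion m0 (w - 'X_[m] *: y - d u)].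
Proof.
move=> sqf qis npm hv hw tv tw.
have [l0 hl0] := eventually_neg_eq m0 npm.
have [l [/hl0 nl ev ew]] := common_power l0 tv tw.
have comm : p + mdegZ (m0 *+ l)%MM + mdegZ m = p + mdegZ m + mdegZ (m0 *+ l)%MM.
  by rewrite addrAC.
have comm' (N : lmodType {mpoly k[n]}) (z : N) :
    'X_[m] *: ('X_[m0 *+ l] *: z) = 'X_[m0 *+ l] *: ('X_[m] *: z).
  by rewrite !scalerA mulrC.
have hw' := GamX (m0 *+ l) hw; rewrite -comm in hw'.
have dv' : d ('X_[m0 *+ l] *: v) = 0 by rewrite dX.
have e' : 'X_[m] *: ('X_[m0 *+ l] *: v) = d ('X_[m0 *+ l] *: w).
  by apply/eqP; rewrite dX comm' -subr_eq0 -scalerBr ew.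
have [y [u [hy hu ey eu]]] := qis _ _ nl _ _ _ (GamX _ hv) hw' dv' e'.
rewrite comm in hu.
have [y' hy' ey'] := Gam_divide sqf hy; have [u' hu' eu'] := Gam_divide sqf hu.
exists y', u'; split=> //; exists l.
  by rewrite scalerBr ey -dX ey' subrr.
by rewrite !scalerBr eu -dX eu' -comm' ey' addrAC addrK subrr.
Qed.

(** A cocycle [(v, w)] of the cone on the torsion subcomplex is the boundary of
    some [(y, u)] in the ambient cone, and [(y, u)] is then a cocycle modulo
    torsion. It is, modulo torsion, the boundary of some [(y2, u2)], so
    subtracting that boundary moves [(y, u)] into the subcomplex. *)
Lemma quasi_iso_cons G m0 :
  (forall v : C 1, v = 0) -> squarefree m0 ->
  mulX_quasi_iso G -> mulX_quasi_iso (m0 :: G).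
Proof.
move=> C1 sqf qis p m npm i v w /Gam_cons[tv hv] /Gam_cons[tw hw] dv e.
have [y [u [hy hu ey eu]]] := qis _ _ npm _ _ _ hv hw dv e.
case: i => [|i] in v w tv hv tw hw dv e y u hy hu ey eu *.
  (* The cochain [y] lives in the zero module [C 1]. *)
  exists 0, 0; split; try exact: Gam0.
    by rewrite ey (C1 y).
  by rewrite (C1 w) scaler0 !linear0 addr0.
have ty : Xpower_torsion m0 (d y) by rewrite -ey.
have tu : Xpower_torsion m0 ('X_[m] *: y - d (- u)) by rewrite linearN opprK -eu.
have [y2 [u2 [hy2 hu2 ty2 tu2]]] :=
  relative_quasi_iso sqf qis npm hy (GamN hu) ty tu.
(* The sign of [u] is that of the differential of the cone. *)
exists (y - d y2), (u + 'X_[m] *: y2 + d u2); split.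
- apply/Gam_cons; split=> //; apply: GamB => //; exact: Gam_d.
- apply/Gam_cons; split.
    have [l hl] := tu2; exists l; rewrite -[_ + _ + _]opprK scalerN !opprD.
    by rewrite hl oppr0.
  by apply: GamD; [apply: GamD => //; apply: GamX | apply: Gam_d].
- by rewrite linearB /= ic_dd subr0.
- by rewrite !linearD /= ic_dd addr0 dX scalerN eu addrACA addNr addr0.
Qed.

Definition finite_cohomology G := forall p i,
  fin_quotient (@Gam_cocycle G i.+1 p) (@Gam_coboundary G i p).

(** Finite dimension of the degree [p] cohomology of the quotient of
    [Gamma_G(C)] by its [m0]-torsion, in a form that speaks of the images under
    the connecting map: two relative cocycles [y] and [y'] with
    [d y - d y' = d x] for a torsion element [x] have the same image in the
    cohomology of the subcomplex. The quotient inverts [m0], so its cohomology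
    in degree [p] is that of [Gamma_G(C)] in degree [p + l deg m0] for any
    [l >= l0]; a spanning set in degree [p + l0 deg m0] is divided by
    [m0^l0]. *)
Lemma relative_cocycle_span G m0 p i : 
  (forall v : C 0, v = 0) -> 
  squarefree m0 -> mulX_quasi_iso G -> finite_cohomology G ->
  exists2 bs : seq (C i),
   forall b, b \in bs -> Gam G p b /\ Xpower_torsion m0 (d b) &
   forall y, Gam G p y -> Xpower_torsion m0 (d y) ->
   kspan bs (fun y' => exists2 x, Gam G p x & d x = d y' /\ Xpower_torsion m0 x) y.
Proof.
move=> C0 sqf qis fin; case: i => [|i].
  exists [::] => // y _ _ /=; exists 0; first exact: Gam0.
  by rewrite (C0 y); split=> //; exists 0%N; rewrite scaler0.
have [l0 hl0] := eventually_neg_stable p m0.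
have [bs bsZ hbs] := fin (p + mdegZ (m0 *+ l0)%MM) i.
have [b /bsZ[bG _]|xs xsG exs] := @preimage_seq _ _ (fun x : C i.+1 => 'X_[m0 *+ l0] *: x) (Gam G p) bs.
  by have [x] := Gam_divide sqf bG; exists x.
exists xs => [x xxs|y hy [l1 ty]].
  split; first exact: xsG.
  have [|_ xz] := bsZ ('X_[m0 *+ l0] *: x); first by rewrite exs; apply: (map_f (fun x : C i.+1 => _)).
  by exists l0; rewrite -dX.
pose t := (maxn l0 l1 - l0)%N; pose l := (l0 + t)%N.
have dy : d ('X_[m0 *+ l] *: y) = 0.
  by rewrite dX; apply: killX_le ty; rewrite /l /t subnKC ?leq_maxr // leq_maxl.
have hy' := GamX (m0 *+ l) hy.
rewrite /l mulmDn mdegZD addrA in hy'.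
(* Surjectivity of [m0^t] on cohomology: the cone cocycle is [(0, m0^l y)]. *)
have [] := qis _ _ (hl0 t) i 0 _ (Gam0 _ _ _) hy'.
- exact: linear0.
- by rewrite scaler0 -mulmDn.
move=> z [s [hz hs ez es]].
have hb : kspan bs (@Gam_coboundary G i (p + mdegZ (m0 *+ l0)%MM)) z by apply: hbs; split.
rewrite exs in hb.
(* [R y z]: the class of [y] is that of [z / m0^l0] in the localization. *)
pose R (y z : C i.+1) := Gam G p y /\ exists2 s : C i, Gam G (p + mdegZ (m0 *+ l)%MM) s &
  'X_[m0 *+ l] *: y = 'X_[m0 *+ t] *: z + d s.
apply: (kspan_transfer (R := R)) hb.
- move=> b c y' z' bxs [hy1 [s' hs' e']]; split.
    by apply: GamB => //; apply: GamC; apply: xsG.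
  exists s' => //; rewrite !scalerBr e' addrAC; congr (_ - _ + _).
  by rewrite !scalerA [in RHS]mulrCA -mpolyXD addmC -mulmDn mulrC.
- move=> y' z' [hy1 [s' hs' e']] [a ha ea].
  have hs2 : Gam G (p + mdegZ (m0 *+ l)%MM) ('X_[m0 *+ t] *: a + s').
    apply: GamD => //; rewrite /l mulmDn mdegZD addrA; exact: GamX.
  have [x hx ex] := Gam_divide sqf hs2.
  exists (y' - d x); first by apply: GamB => //; apply: Gam_d.
  split; first by rewrite linearB /= ic_dd subr0.
  by exists l; rewrite scalerBr -dX ex linearD /= dX e' ea subrr.
- split=> //; exists s; last by rewrite /l mulmDn.
  by rewrite /l mulmDn mdegZD addrA.
Qed.

(** The long exact sequence: classes of the subcomplex are a subspace of the
    ambient cohomology ([bs1]) together with the image of the relative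
    cohomology under the connecting map ([d bs2]). *)
Lemma finite_cohomology_cons G m0 :
  (forall v : C 0, v = 0) -> squarefree m0 -> mulX_quasi_iso G ->
  finite_cohomology G -> finite_cohomology (m0 :: G).
Proof.
move=> C0 sqf qis fin p i.
have hZ : ksubspace (@Gam_cocycle (m0 :: G) i.+1 p).
  split; first by split; [apply: Gam0 | apply: linear0].
  move=> c u v [u1 u2] [v1 v2]; split; first by apply: GamB => //; apply: GamC.
  by rewrite linearB linearZ /= u2 v2 scaler0 subrr.
have hB : ksubspace (@Gam_coboundary G i p).
  split; first by exists 0; [apply: Gam0 | rewrite linear0].
  move=> c u v [u1 u2 ->] [v1 v2 ->]; exists (u1 - c%:MP *: v1).
    by apply: GamB => //; apply: GamC.
  by rewrite linearB [d (_ *: v1)]linearZ.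
have [bs bsZ hbs] := fin p i.
have [|bs1 bs1Z hbs1] := @kspan_sub k n _ bs _ _ hZ hB.
  by move=> v [/Gam_cons[_ v1] v2]; apply: hbs.
have [bs2 bs2Z hbs2] := @relative_cocycle_span G m0 p i C0 sqf qis fin.
exists (bs1 ++ [seq (d b : C i.+1) | b <- bs2]) => [b|v /hbs1].
  rewrite mem_cat => /orP[/bs1Z //|/mapP[x /bs2Z[x1 x2] ->]].
  by split; [apply/Gam_cons; split=> //; apply: Gam_d | apply: ic_dd].
apply: kspan_trans => w [[y hy ew] [/Gam_cons[tw _] _]].
rewrite ew in tw; have := hbs2 _ hy tw; rewrite ew.
elim: bs2 {bs2Z hbs2 hy ew tw} y => [|b bs2 IH] y /=.
  by move=> [x x1 [x2 x3]]; exists x => //; apply/Gam_cons.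
by move=> [c /IH hc]; exists c; rewrite -linearZ -linearB.
Qed.

End TorsionSubcomplex.

(** * The resolution of S *)

Section Base.
Variables (k : fieldType) (n : nat).
Local Notation S := {mpoly k[n]}.

Lemma zero_grading : @is_grading k n 'rV[S]_0 (fun _ _ => True).
Proof.
split=> //.
- by move=> v; exists [::], (fun=> 0); rewrite big_nil; split=> //; apply: thinmx0.
- by move=> *; apply: thinmx0.
Qed.

Definition zero_gmod : gmod k n := GMod zero_grading.

Lemma zero_gmod_eq0 (v : zero_gmod) : v = 0.
Proof. exact: thinmx0. Qed.

Lemma zero_gmod_injective : graded_injective zero_gmod.
Proof.
move=> A C f g _ _ _; exists (\0 : {linear C -> zero_gmod}) => // v.
by rewrite [RHS]zero_gmod_eq0.
Qed.

Section Resolution.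
Variable E : injective_resolution (Sgmod k n).

(** Two zero modules in front let all index shifts of the cone argument take
    place inside the natural numbers. *)
Definition res_obj i : gmod k n :=
  if i is i'.+2 then ir_obj E i' else zero_gmod.

Definition res_d i : {linear res_obj i -> res_obj i.+1} :=
  match i return {linear res_obj i -> res_obj i.+1} with
  | 0 => \0
  | 1 => \0
  | i'.+2 => ir_d E i'
  end.

Lemma res_inj i : graded_injective (res_obj i).
Proof.
by case: i => [|[|i]]; [apply: zero_gmod_injective.. | apply: ir_inj].
Qed.

Lemma res_homog i : homogeneous (res_d i).
Proof.
case: i => [|[|i]] //= p v hv; first exact: (@gm_deg0 k n (ir_obj E 0) p).
exact: ir_d_homog hv.
Qed.

Lemma res_dd i (v : res_obj i) : res_d i.+1 (res_d i v) = 0.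
Proof.
case: i v => [|[|i]] v /=; [by [] | exact: linear0 |].
by apply/ir_exactS; exists v.
Qed.

Definition resolution_complex : injective_complex k n :=
  InjectiveComplex res_inj res_homog res_dd.

Lemma homogeneous_lift (A C : gmod k n) (f : {linear A -> C}) p w :
  homogeneous f -> gm_deg C p (f w) -> exists2 w0, gm_deg A p w0 & f w = f w0.
Proof.
move=> hf hw; have [w0 c0] := component_exists p w; exists w0; first by case: c0.
exact: component_uniq (component_homog hw) (component_linear hf c0).
Qed.

(** If [p + deg m] is in the positive orthant and [neg p] is the same set, then
    so is [p]; otherwise both components of [S] vanish. *)
Lemma Sdeg_divide p m (s : S) : neg p = neg (p + mdegZ m) ->
  Sdeg (p + mdegZ m) s -> exists2 s', Sdeg p s' & s = 'X_[m] * s'.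
Proof.
move=> /neg_eqP npm hs; exists (divX m s).
  move=> w; rewrite mcoeff_msupp mcoeff_divX -mcoeff_msupp => /hs.
  by rewrite mdegZD addrC => /addIr.
rewrite [in RHS](mpolyE s) divX_sum mulr_sumr [LHS]mpolyE.
apply: eq_big_seq => w ws; rewrite divXZ divX_mpolyX.
have mw : (m <= w)%MM.
  apply/mnm_lepP => j; have /rowP /(_ j) := hs _ ws; have := npm j.
  rewrite !mxE; set x := p ord0 j; lia.
by rewrite mw -scalerAr -mpolyXD addmC submK.
Qed.

(** The cohomology of the complex is [S] in position [2], where [X^m] is
    injective and, by [Sdeg_divide], surjective; elsewhere the complex is exact. *)
Lemma resolution_quasi_iso : mulX_quasi_iso resolution_complex [::].
Proof.
move=> p m npm i v w [hv _] [hw _] dv e.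
have tors0 (V : lmodType S) (x : V) : mono_torsion [::] x by exists 0%N.
case: i v w hv hw dv e => [|[|i]] /= v w hv hw dv e.
- exists 0, 0; suff v0 : v = 0.
    by split; [apply: Gam0.. | exact: v0 | exact: etrans (thinmx0 _) (esym (thinmx0 _))].
  have [s es] := (ir_exact0 v).1 dv.
  move: e; rewrite es -linearZ -[RHS](linear0 (ir_aug E)).
  move=> /(@ir_aug_inj _ _ _ E) /eqP; rewrite mulf_eq0 => /orP[/eqP e|/eqP ->]; last exact: linear0.
  have := congr1 (mcoeff m) e; rewrite mcoeffX eqxx mcoeff0 => /eqP.
  by rewrite oner_eq0.
- have [w0 ew0] := (ir_exactS v).1 dv.
  have hv' : gm_deg (ir_obj E 1) p (ir_d E 0 w0) by rewrite -ew0.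
  have [w1 hw1 ew1] := homogeneous_lift (@ir_d_homog _ _ _ E 0) hv'.
  have /ir_exact0 [s es] : ir_d E 0 (w - 'X_[m] *: w1) = 0.
    by rewrite linearB [ir_d E 0 (_ *: _)]linearZ /= -ew1 -ew0 e subrr.
  have hs : gm_deg (ir_obj E 0) (p + mdegZ m) (ir_aug E s).
    by rewrite -es; apply: gm_degB => //; apply: gm_degX.
  have [s1 hs1 es1] := homogeneous_lift (@ir_aug_homog _ _ _ E) hs.
  have [s2 hs2 es2] := Sdeg_divide npm hs1.
  exists (w1 + ir_aug E s2), 0; split.
  + by split=> //; apply: gm_degD => //; apply: ir_aug_homog.
  + exact: Gam0.
  + have da : ir_d E 0 (ir_aug E s2) = 0 by apply/ir_exact0; exists s2.
    by rewrite linearD /= ew0 ew1 da addr0.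
  + rewrite addr0 scalerDr -linearZ /=.
    have -> : 'X_[m] *: (s2 : Sgmod k n) = s1 by rewrite es2.
    by rewrite -es1 -es addrC subrK.
- have [w0 ew0] := (ir_exactS v).1 dv.
  have hv' : gm_deg (ir_obj E i.+2) p (ir_d E i.+1 w0) by rewrite -ew0.
  have [w1 hw1 ew1] := homogeneous_lift (@ir_d_homog _ _ _ E i.+1) hv'.
  have /ir_exactS [u eu] : ir_d E i.+1 (w - 'X_[m] *: w1) = 0.
    by rewrite linearB [ir_d E _ (_ *: _)]linearZ /= -ew1 -ew0 e subrr.
  have hu : gm_deg (ir_obj E i.+1) (p + mdegZ m) (ir_d E i u).
    by rewrite -eu; apply: gm_degB => //; apply: gm_degX.
  have [u1 hu1 eu1] := homogeneous_lift (@ir_d_homog _ _ _ E i) hu.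
  exists w1, u1; split=> //; first by rewrite -ew1.
  by rewrite /= -eu1 -eu addrC subrK.
Qed.

Lemma resolution_finite : finite_cohomology resolution_complex [::].
Proof.
have tors0 (V : lmodType S) (x : V) : mono_torsion [::] x by exists 0%N.
move=> p [|[|i]].
- exists [::] => //= v _; exists 0; first exact: Gam0.
  by rewrite linear0; apply: thinmx0.
- have lift (v : ir_obj E 0) : gm_deg (ir_obj E 0) p v -> ir_d E 0 v = 0 ->
      exists2 s, Sdeg p s & v = ir_aug E s.
    move=> hv /ir_exact0[s0 es0]; rewrite es0 in hv.
    have [s hs es] := homogeneous_lift (@ir_aug_homog _ _ _ E) hv.
    by exists s; rewrite // es0.
  have cob0 : Gam_coboundary (C := resolution_complex) (i:=1) [::] p 0.
    by exists 0; [apply: Gam0 | rewrite linear0].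
  have [[u eu]|no] := classic (exists u : 'X_{1..n}, mdegZ u = p).
    exists [:: ir_aug E ('X_[u] : S)] => [b|v [[hv _] dv]].
      rewrite inE => /eqP ->; split; last by apply/ir_exact0; exists ('X_[u] : S).
      split=> //; apply: ir_aug_homog; rewrite -eu; exact: Sdeg_mpolyX.
    have [s hs ->] := lift v hv dv.
    exists s@_u; rewrite -linearZ -linearB /=.
    have -> : s - (s@_u)%:MP *: ('X_[u] : Sgmod k n) = 0; last by rewrite linear0.
    apply/mpolyP => w; rewrite mcoeffB /GRing.scale /= mcoeffCM mcoeffX mcoeff0.
    have [<-|ne] := eqVneq u w; first by rewrite mulr1 subrr.
    rewrite mulr0 subr0; apply: memN_msupp_eq0; apply: contra ne => /hs.
    by rewrite -eu => /mdegZ_inj ->.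
  exists [::] => // v [[hv _] dv] /=; have [s hs ->] := lift v hv dv.
  suff -> : s = 0 by rewrite linear0.
  apply/mpolyP => w; rewrite mcoeff0; apply: memN_msupp_eq0; apply/negP => /hs e.
  by apply: no; exists w.
- exists [::] => // v [[hv _] dv] /=.
  have [w0 ew0] := (ir_exactS v).1 dv; rewrite ew0 in hv.
  have [w1 hw1 ew1] := homogeneous_lift (@ir_d_homog _ _ _ E i) hv.
  by exists w1; [split | rewrite ew0].
Qed.

Lemma resolution_torsion G : all (@squarefree n) G ->
  mulX_quasi_iso resolution_complex G /\ finite_cohomology resolution_complex G.
Proof.
elim: G => [|m G IH] /=.
  by move=> _; split; [apply: resolution_quasi_iso | apply: resolution_finite].
move=> /andP[msqf /IH[qis fin]]; split.
  by apply: quasi_iso_cons => // v; apply: zero_gmod_eq0.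
by apply: finite_cohomology_cons => // v; apply: zero_gmod_eq0.
Qed.

End Resolution.
End Base.

(** * Torsion along a square-free monomial ideal *)

Section TorsionMonomial.
Variables (k : fieldType) (n : nat).
Local Notation S := {mpoly k[n]}.

(** A generator that is listed as often as a multiple of the characteristic
    contributes nothing to the sums, so it must be left out when repetitions
    are removed. *)
Lemma uniq_generators (B : S -> Prop) : generated_by_squarefree_monomials B ->
  exists G : seq 'X_{1..n}, [/\ uniq G, all (@squarefree n) G &
    forall f, B f <-> exists c : 'X_{1..n} -> S, f = \sum_(m <- G) c m * 'X_[m]].
Proof.
move=> [G Gsqf hB].
pose a m : k := (count_mem m G)%:R.
exists [seq m <- undup G | a m != 0]; split.
- by rewrite filter_uniq // undup_uniq.
- apply/allP => m; rewrite mem_filter mem_undup => /andP[_]; exact: (allP Gsqf).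
move=> f.
have sumE (c : 'X_{1..n} -> S) : \sum_(m <- G) c m * 'X_[m] =
    \sum_(m <- [seq m <- undup G | a m != 0]) ((a m)%:MP * c m) * 'X_[m].
  rewrite -big_undup_iterop_count big_filter [RHS]big_mkcond.
  apply: eq_bigr => m _; rewrite -[iterop _ _ _ _]/(_ *+ _) -mulr_natl -mpolyC_nat.
  rewrite mulrA /a; case: eqP => //= ->.
  by rewrite mpolyC0 !mul0r.
split=> [/hB[c ->]|[c ->]]; first by exists (fun m => (a m)%:MP * c m).
apply/hB; exists (fun m => ((a m)^-1)%:MP * c m); rewrite sumE.
apply: eq_big_seq => m; rewrite mem_filter => /andP[am _].
by rewrite mulrA -mpolyCM divff // mpolyC1 mul1r.
Qed.

Lemma sum_split_count (t : seq 'X_{1..n}) u : (\sum_(w <- t) w =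
  u *+ count_mem u t + \sum_(w <- [seq w <- t | w != u]) w)%MM.
Proof.
elim: t => [|w t IH] /=; first by rewrite !big_nil mulm0n addm0.
rewrite big_cons IH; case: eqP => [->|_] /=.
  by rewrite mulmDn mulm1n addmA.
by rewrite big_cons add0n addmA [(w + _)%MM]addmC addmA.
Qed.

(** Pigeonhole: a product of more than [size G * l] factors from [G] contains
    some factor at least [l] times. *)
Lemma kill_word (V : lmodType S) (G t : seq 'X_{1..n}) l (v : V) :
  (forall u, u \in G -> 'X_[u *+ l] *: v = 0) -> {subset t <= G} ->
  (size G * l < size t)%N -> 'X_[(\sum_(w <- t) w)%MM] *: v = 0.
Proof.
elim: G t => [|u G IH] t hv tG; first by case: t tG => // w t /(_ w (mem_head _ _)).
rewrite (sum_split_count t u) => /= st.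
have [hl|hl] := leqP l (count_mem u t).
  rewrite addmC mulX_scale (killX_le hl) ?scaler0 //.
  by apply: hv; apply: mem_head.
rewrite mulX_scale IH ?scaler0 //.
- by move=> w wG; apply: hv; rewrite inE wG orbT.
- by move=> w; rewrite mem_filter => /andP[wu /tG]; rewrite inE (negbTE wu).
- move: st; rewrite size_filter -(count_predC (pred1 u) t).
  have -> : count (fun w => w != u) t = count (predC (pred1 u)) t by [].
  nia.
Qed.

Section FixB.
Variables (B : S -> Prop) (G : seq 'X_{1..n}).
Hypothesis uG : uniq G.
Hypothesis hB : forall f, B f <-> exists c : 'X_{1..n} -> S, f = \sum_(m <- G) c m * 'X_[m].

Lemma ideal_pow_kill (V : lmodType S) L b (v : V) :
  (forall t, {subset t <= G} -> size t = L -> 'X_[(\sum_(w <- t) w)%MM] *: v = 0) ->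
  ideal_pow B L b -> b *: v = 0.
Proof.
elim: L b v => [|L IH] b v hv /=.
  move=> _; have := hv [::] (fun _ => _) erefl.
  by rewrite big_nil mpolyX0 scale1r => -> //; rewrite scaler0.
move=> [s hs ->]; rewrite scaler_suml big_seq big1 // => ab /hs[/hB[c ->] hb].
rewrite mulrC -scalerA scaler_suml scaler_sumr big_seq big1 // => m mG.
rewrite -scalerA scalerA mulrC -scalerA (IH _ ('X_[m] *: v)) ?scaler0 //.
move=> t tG st; rewrite -mulX_scale addmC.
have := hv (m :: t); rewrite big_cons; apply; last by rewrite /= st.
by move=> w; rewrite inE => /orP[/eqP ->|/tG].
Qed.

Lemma torsionE (V : lmodType S) (v : V) : torsion B v <-> mono_torsion G v.
Proof.
split=> [[l hl]|[l hl]].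
  exists l => u uG'; apply: hl.
  have Bu : B 'X_[u].
    apply/hB; exists (fun m => (m == u)%:R).
    rewrite (bigD1_seq u) //= eqxx mul1r big1 ?addr0 // => m /negbTE ->.
    by rewrite mul0r.
  elim: l => [|l IH] //=; exists [:: ('X_[u], 'X_[u *+ l])].
    by move=> ab; rewrite inE => /eqP ->.
  by rewrite big_seq1 /= mulmS mpolyXD.
exists (size G * l).+1 => b; apply: ideal_pow_kill => t tG st.
by apply: kill_word hl tG _; rewrite st.
Qed.

End FixB.
End TorsionMonomial.

(** * Local cohomology in single degrees *)

Section LocalCohomology.
Variables (k : fieldType) (n : nat) (B : {mpoly k[n]} -> Prop) (i : nat) (H : gmod k n).
Hypothesis hB : generated_by_squarefree_monomials B.
Hypothesis hH : is_local_cohomology B i (Sgmod k n) H.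

(** The given description of [H] in terms of arbitrary cocycles restricts to
    each degree, since homogeneous components of cocycles are cocycles. *)
Lemma local_cohomology_by_degree : exists (G : seq 'X_{1..n})
    (E : injective_resolution (Sgmod k n)) (pi : resolution_complex E i.+2 -> H),
  let C := resolution_complex E in
  [/\ mulX_quasi_iso C G /\ finite_cohomology C G,
      forall p a (v : C i.+2), Gam_cocycle G p v ->
        gm_deg H p (pi v) /\ pi (a *: v) = a *: pi v,
      forall p (u v : C i.+2), Gam_cocycle G p u -> Gam_cocycle G p v ->
        pi (u - v) = pi u - pi v,
      forall p (v : C i.+2), Gam_cocycle G p v ->
        (pi v = 0 <-> @Gam_coboundary _ _ C G i.+1 p v) &
      forall p (h : H), gm_deg H p h -> exists2 v, Gam_cocycle G p v & pi v = h].
Proof.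
have [G [uG Gsqf hBG]] := uniq_generators hB.
have [E [pi [piL pideg pi0 pisurj]]] := hH.
have tE (V : lmodType {mpoly k[n]}) (v : V) := torsionE uG hBG v.
have coc p (v : resolution_complex E i.+2) : Gam_cocycle G p v -> cocycle B v.
  by move=> [[_ tv] dv]; split=> //; apply/tE.
have coc0 : cocycle B (0 : ir_obj E i).
  by split; [apply/tE; apply: mono_torsion0 | apply: linear0].
have cob0 : coboundary B (0 : ir_obj E i).
  case: (i) => [|j] //=; exists 0; last by rewrite linear0.
  by apply/tE; apply: mono_torsion0.
have pi00 : pi 0 = 0 by apply/(pi0 0 coc0).
have cocZ a (v : ir_obj E i) : cocycle B v -> cocycle B (a *: v).
  move=> [/tE tv dv]; split; first by apply/tE; apply: mono_torsionZ.
  by rewrite linearZ /= dv scaler0.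
have piZ a v : cocycle B v -> pi (a *: v) = a *: pi v.
  by move=> cv; have := piL a v 0 cv coc0; rewrite pi00 !addr0.
have piD u v : cocycle B u -> cocycle B v -> pi (u + v) = pi u + pi v.
  by move=> cu cv; have := piL 1 u v cu cv; rewrite !scale1r.
exists G, E, pi; split.
- exact: resolution_torsion.
- move=> p a v hv; have cv := coc _ _ hv; split; last exact: piZ.
  by apply: pideg => //; case: hv => -[].
- move=> p u v /coc cu /coc cv; rewrite -[- v]scaleN1r piD //; last exact: cocZ.
  by rewrite piZ // scaleN1r.
- move=> p v hv; rewrite (pi0 _ (coc _ _ hv)).
  case: hv => -[hv _] _; split.
    case: (i) v hv {coc pi piL pideg pi0 pisurj coc0 cob0 pi00 piZ piD cocZ}
      => [|j] v hv /=.
      move=> ->; exists 0; first exact: Gam0.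
      by rewrite linear0.
    move=> [w /tE tw e]; rewrite e in hv *.
    have [w0 c0] := component_exists p w.
    exists w0; first by split; [case: c0 | apply: mono_torsion_component c0 tw].
    exact: component_uniq (component_homog hv) (component_linear (@ir_d_homog _ _ _ E j) c0).
  case: (i) v hv {coc pi piL pideg pi0 pisurj coc0 cob0 pi00 piZ piD cocZ}
      => [|j] v hv /= [w [hw tw] ->] //=.
  by exists w => //; apply/tE.
- move=> p h hh; have [v [/tE tv dv] e] := pisurj h.
  have [s [f [us hf ev]]] := grading_span (gm_grading (ir_obj E i)) v.
  have cf q : q \in s -> Gam_cocycle (C := resolution_complex E) (i := i.+2) G q (f q).
    move=> qs; have cq : component q v (f q).
      split=> //; rewrite ev (bigD1_seq q) //= addrAC subrr add0r -big_filter.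
      apply: off_degree_sum => q'; rewrite mem_filter => /andP[ne _].
      exact: off_degree_homog ne (hf q').
    split; first by split=> //; apply: mono_torsion_component cq tv.
    have := component_linear (@ir_d_homog _ _ _ E i) cq; rewrite dv => c.
    apply: component_uniq c _; apply: component_homog; exact: gm_deg0.
  have cs (r : seq (Zn n)) : {subset r <= s} ->
      cocycle B (\sum_(q <- r) f q) /\ pi (\sum_(q <- r) f q) = \sum_(q <- r) pi (f q).
    elim: r => [|q r IH] rs; first by rewrite !big_nil.
    have [q' q'r|c1 e1] := IH; first by apply: rs; rewrite inE q'r orbT.
    have c2 := coc _ _ (cf q (rs q (mem_head _ _))).
    rewrite !big_cons; split; last by rewrite piD // e1.
    case: c1 c2 => /tE t1 d1 [/tE t2 d2]; split; first by apply/tE/mono_torsionD.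
    by rewrite linearD /= d1 d2 addr0.
  have eh : h = \sum_(q <- s) pi (f q) by rewrite -e ev (cs s (fun _ => id)).2.
  have hpi q : q \in s -> gm_deg H q (pi (f q)).
    by move=> qs; apply: pideg => //; apply: coc (cf q qs).
  have off (r : seq (Zn n)) : {subset r <= s} -> p \notin r ->
      off_degree p (\sum_(q <- r) pi (f q)).
    move=> rs pr; apply: off_degree_sum => q qr; apply: off_degree_homog (hpi q (rs q qr)).
    by apply: contraNneq pr => <-.
  have [ps|ps] := boolP (p \in s).
    exists (f p); first exact: cf.
    apply: (component_uniq (p := p) (v := h)); last exact: component_homog.
    split; first exact: hpi.
    rewrite eh (bigD1_seq p) //= addrAC subrr add0r -big_filter.
    apply: off; first by move=> q; rewrite mem_filter => /andP[].
    by rewrite mem_filter eqxx.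
  exists 0; first by split; [apply: Gam0 | apply: linear0].
  rewrite pi00; apply/esym; apply: off_degree_eq0 hh _.
  by rewrite eh; apply: off.
Qed.

Definition nonzero_in p := exists2 h : H, gm_deg H p h & h <> 0.

Lemma nonzero_mulX p m : neg p = neg (p + mdegZ m) ->
  nonzero_in p <-> nonzero_in (p + mdegZ m).
Proof.
have [G [E [pi [[qis _] piZ piB pi0 piS]]]] := local_cohomology_by_degree.
move=> npm; split=> -[h hh nz].
  have [v hv ev] := piS _ _ hh.
  have hXv : Gam_cocycle (C := resolution_complex E) (i := i.+2) G (p + mdegZ m) ('X_[m] *: v).
    case: hv => hv dv; split; first exact: GamX.
    by rewrite dX dv scaler0.
  exists (pi ('X_[m] *: v)); first by case: (piZ _ 1 _ hXv).
  move=> /(pi0 _ _ hXv)[w hw e]; apply: nz; rewrite -ev; apply/(pi0 _ _ hv).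
  have [y [u [hy _ ey _]]] := qis _ _ npm _ _ _ hv.1 hw hv.2 e.
  by exists y.
have [w [hw dw] ew] := piS _ _ hh.
(* A class in degree [p + deg m] is a multiple of one in degree [p]. *)
have [|y [u [hy hu ey eu]]] := qis _ _ npm i.+1 0 w (Gam0 _ _ _ _) hw (linear0 _).
  by rewrite scaler0 dw.
have hy' : Gam_cocycle G p y by split.
exists (pi y); first by case: (piZ _ 1 _ hy').
move=> /(pi0 _ _ hy')[z hz ez]; apply: nz; rewrite -ew; apply/(pi0 (p + mdegZ m)); first by split.
exists ('X_[m] *: z + u); first by apply: GamD => //; apply: GamX.
by rewrite eu ez -dX linearD.
Qed.

(** Two points with the same negative coordinates are compared through their
    coordinatewise maximum, which again has these negative coordinates. *)
Lemma nonzero_neg p q : neg p = neg q -> nonzero_in p -> nonzero_in q.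
Proof.
move=> /neg_eqP npq.
pose mp : 'X_{1..n} := [multinom if (p ord0 j <= q ord0 j)%R then `|q ord0 j - p ord0 j|%N else 0%N | j < n].
pose mq : 'X_{1..n} := [multinom if (p ord0 j <= q ord0 j)%R then 0%N else `|p ord0 j - q ord0 j|%N | j < n].
have e : p + mdegZ mp = q + mdegZ mq.
  apply/rowP => j; rewrite !mxE !mnmE !ord1; set a := p 0 j; set b := q 0 j; case: (leP a b); lia.
have e1 : neg p = neg (p + mdegZ mp).
  apply/neg_eqP => j; rewrite !mxE !mnmE; have := npq j; rewrite !ord1; set a := p 0 j; set b := q 0 j; case: (leP a b); lia.
have e2 : neg q = neg (q + mdegZ mq).
  apply/neg_eqP => j; rewrite !mxE !mnmE; have := npq j; rewrite !ord1; set a := p 0 j; set b := q 0 j; case: (leP a b); lia.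
by move=> /(nonzero_mulX e1); rewrite e => /(nonzero_mulX e2).
Qed.

Lemma nonzero_Sigma p : nonzero_in p <-> Sigma H (neg p).
Proof.
split=> [nz q e|]; last exact.
by apply: nonzero_neg nz; rewrite e.
Qed.

Lemma finite_dim_degree p : fin_quotient (gm_deg H p) (eq^~ 0).
Proof.
have [G [E [pi [[_ fin] piZ piB pi0 piS]]]] := local_cohomology_by_degree.
have [bs bsZ hbs] := fin p i.+1.
exists [seq pi b | b <- bs] => [_ /mapP[b /bsZ hb ->]|h hh].
  by case: (piZ _ 1 _ hb).
have [v hv <-] := piS _ _ hh.
have := hbs _ hv; elim: bs v hv bsZ {hbs h hh} => [|b bs IH] v hv bsZ /=.
  by move=> hc; apply/(pi0 _ _ hv).
have hb : Gam_cocycle G p b by apply: bsZ; apply: mem_head.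
move=> [c hc]; exists c.
have hcb : Gam_cocycle G p (c%:MP *: b).
  case: hb => hb db; split; first exact: GamC.
  by rewrite linearZ /= db scaler0.
have hvb : Gam_cocycle G p (v - c%:MP *: b).
  split; first by apply: GamB; [case: hv | case: hcb].
  by rewrite linearB /= hv.2 hcb.2 subrr.
have -> : pi v - c%:MP *: pi b = pi (v - c%:MP *: b).
  by rewrite (piB p) // (piZ _ c%:MP _ hb).2.
by apply: IH hc => // x xbs; apply: bsZ; rewrite inE xbs orbT.
Qed.

End LocalCohomology.

(** * Coarser gradings *)

Lemma finite_pred_exists (J : finType) (A : eqType) (P : J -> A -> Prop) :
  (forall j, finite_pred (P j)) -> finite_pred (fun x => exists j, P j x).
Proof.
move=> h.
have [s hs] : exists s : seq A, forall j, j \in enum J -> forall x, P j x -> x \in s.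
  elim: (enum J) => [|j js [s hs]]; first by exists [::].
  have [s' hs'] := h j; exists (s' ++ s) => j'; rewrite inE.
  by case/orP => [/eqP ->|/hs hj] x hx; rewrite mem_cat ?(hs' _ hx) ?(hj _ hx) ?orbT.
by exists s => x [j]; apply: hs; rewrite mem_enum.
Qed.

Section Coarse.
Variables (k : fieldType) (n : nat) (N : gmod k n) (D : zmodType) (phi : Zn n -> D).

Lemma coarse_deg_homog p v : gm_deg N p v -> coarse_deg phi (phi p) v.
Proof.
move=> hv; exists [:: p], (fun q => if q == p then v else 0); split.
- by move=> q; rewrite inE => /eqP ->.
- by move=> q; case: eqP => [->|_] //; apply: gm_deg0.
- by rewrite big_seq1 eqxx.
Qed.

Lemma off_degreeC p (c : k) (v : N) : off_degree p v -> off_degree p (c%:MP *: v).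
Proof.
move=> [l hl ->]; rewrite scaler_sumr; apply: off_degree_sum => x /hl[ne hx].
exact: off_degree_homog ne (gm_degC c hx).
Qed.

(** Finitely many spanning vectors have components in finitely many degrees
    only, and a homogeneous element of another degree is not in their span. *)
Lemma finite_dim_support (delta : D) : finite_dim (coarse_deg phi (N := N) delta) ->
  finite_pred (fun q => phi q = delta /\ exists2 v, gm_deg N q v & v <> 0).
Proof.
move=> [r [b [bW bspan]]].
have [j|s hs] := @finite_pred_exists 'I_r (Zn n) (fun j q => ~ off_degree q (b j)).
  have [s [f [_ hf ->]]] := bW j; exists s => q no.
  apply/negPn/negP => qs; apply: no; apply: off_degree_sum => p ps.
  by apply: off_degree_homog (hf p); apply: contraNneq qs => <-.
exists s => q [eq_q [v hv nz]]; apply: hs; apply: NNPP => no; apply: nz.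
have [|c ev] := bspan v; first by rewrite -eq_q; apply: coarse_deg_homog.
apply: off_degree_eq0 hv _; rewrite ev.
apply: off_degree_sum => j _; apply: off_degreeC; apply: NNPP => noj.
by apply: no; exists j.
Qed.

Lemma kspan_zero (V : lmodType {mpoly k[n]}) (bs : seq V) (P : V -> Prop) v :
  P v -> kspan bs P v.
Proof.
by elim: bs v => //= b bs IH v Pv; exists 0; rewrite mpolyC0 scale0r subr0; apply: IH.
Qed.

Lemma finite_dim_coarse (delta : D) :
  (forall p, fin_quotient (gm_deg N p) (eq^~ 0)) ->
  finite_pred (fun q => phi q = delta /\ exists2 v, gm_deg N q v & v <> 0) ->
  finite_dim (coarse_deg phi (N := N) delta).
Proof.
move=> fin [s0 hs0].
have hP : ksubspace (eq^~ 0 : N -> Prop).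
  by split=> // c u v -> ->; rewrite scaler0 subrr.
have [bs bsW hbs] : exists2 bs : seq N, forall b, b \in bs -> coarse_deg phi delta b &
    forall q, q \in s0 -> phi q = delta -> forall v, gm_deg N q v -> kspan bs (eq^~ 0) v.
  elim: s0 {hs0} => [|q s [bs bsW hbs]]; first by exists [::].
  have [eq_q|ne] := eqVneq (phi q) delta; last first.
    exists bs => // q'; rewrite inE => /orP[/eqP ->|]; last exact: hbs.
    by move=> e; rewrite e eqxx in ne.
  have [bs' bsW' hbs'] := fin q.
  exists (bs' ++ bs) => [b|q'].
    rewrite mem_cat => /orP[/bsW' hb|/bsW //].
    by rewrite -eq_q; apply: coarse_deg_homog.
  rewrite inE => /orP[/eqP -> _ v /hbs'|q's e v hv].
    by apply: kspan_trans => w ->; apply: kspan_zero.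
  apply: (@kspan_trans k n N bs' bs (kspan bs (eq^~ 0))) => //.
  by apply: kspan_zero; apply: hbs hv.
have [K0 KB] := kspan_ksubspace bs hP.
exists (size bs), (fun j => bs`_j); split=> [j|v [s [f [es hf ->]]]].
  by apply: bsW; apply: mem_nth.
apply: kspan0_sum; rewrite big_seq; apply: big_ind => //.
  move=> x y hx hy; have := KB (-1) _ _ hx hy.
  by rewrite mpolyCN mpolyC1 scaleN1r opprK.
move=> p ps; have [->|nz] := classic (f p = 0); first exact: K0.
apply: (hbs p) => //; last exact: es.
by apply: hs0; split; [apply: es | exists (f p)].
Qed.

End Coarse.

Theorem corollary1p3 (k : fieldType) (n : nat)
    (B : {mpoly k[n]} -> Prop) (hB : generated_by_squarefree_monomials B)
    (M D : zmodType)
    (rho : {additive M -> Zn n}) (phi : {additive Zn n -> D})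
    (rho_inj : injective rho)
    (rho_phi_exact : forall p, phi p = 0 <-> exists m, p = rho m)
    (phi_surj : forall delta, exists p, phi p = delta)
    (i : nat) (H : gmod k n) (hH : is_local_cohomology B i (Sgmod k n) H) :
  (forall (I : {set 'I_n}) (p : Zn n), Sigma H I ->
     finite_pred (fun q : Zn n => (exists m, q = p + rho m) /\ neg q = I))
  <->
  (forall delta : D, finite_dim (coarse_deg phi (N := H) delta)).
Proof.
have fibre p q : phi q = phi p <-> exists m, q = p + rho m.
  have -> : phi q = phi p <-> phi (q - p) = 0.
    by rewrite raddfB; split=> [->|/eqP]; rewrite ?subrr // subr_eq0 => /eqP.
  rewrite rho_phi_exact; split=> -[m e]; exists m; first by rewrite -e addrC subrK.
  by rewrite e addrAC subrr add0r.
split=> [fin delta|fin I p SI].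
  have [p <-] := phi_surj delta.
  apply: finite_dim_coarse (finite_dim_degree hB hH) _.
  have [I|s hs] := @finite_pred_exists {set 'I_n} (Zn n) (fun I q => Sigma H I /\
      (exists m, q = p + rho m) /\ neg q = I).
    have [SI|no] := classic (Sigma H I); last by exists [::] => q [].
    by have [s hs] := fin I p SI; exists s => q [_]; apply: hs.
  exists s => q [/fibre e nz]; apply: hs; exists (neg q); split=> //.
  exact/(nonzero_Sigma hB hH).
have [s hs] := finite_dim_support (fin (phi p)).
exists s => q [/fibre e nI]; apply: hs; split=> //; exact: SI.
Qed.
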